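(* There is no edge-girth-regular graph with parameters $(v,3,7,6)$; that is, for every positive integer $v$, no $egr(v,3,7,6)$-graph exists.
   Context: Graphs are finite, simple and undirected. For integers $v,k,g,\lambda$, an $egr(v,k,g,\lambda)$-graph (edge-girth-regular graph) is a $k$-regular graph on $v$ vertices with girth $g$ (the length of a shortest cycle is exactly $g$) such that every edge is contained in exactly $\lambda$ cycles of length $g$. *)

(* Defs.v *)
From mathcomp Require Import all_boot.
Set Implicit Arguments.
Unset Strict Implicit.
Unset Printing Implicit Defensive.

Record sgraph := SGraph {
  vertex :> finType;
  adj : rel vertex;
  adj_sym : symmetric adj;
  adj_irrefl : irreflexive adj
}.

Section Defs.
Variable G : sgraph.

Definition edges : {set {set G}} :=
  [set [set p.1; p.2] | p : G * G & adj p.1 p.2].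

Definition regular (k : nat) : Prop := forall x : G, #|[set y | adj x y]| = k.

(* [s] lists the vertices of a cycle in cyclic order, without repeating the
   first vertex at the end.  The bound on the size rules out the degenerate
   closed walks [::] and x, y, x. *)
Definition cycle_seq (s : seq G) : bool :=
  [&& 2 < size s, uniq s & cycle (@adj G) s].

Definition cycle_edges (s : seq G) : {set {set G}} :=
  [set [set x; next s x] | x in s].

(* A cycle is a subgraph, represented by its edge set, so that the 2n sequences
   obtained from one another by rotation and reversal count as one cycle. *)
Definition cycles_of_length (n : nat) : {set {set {set G}}} :=
  [set cycle_edges (tval s) | s : n.-tuple G & cycle_seq (tval s)].

Definition is_girth (g : nat) : Prop :=
  cycles_of_length g != set0 /\ forall n, cycles_of_length n != set0 -> g <= n.

Definition egr (v k g l : nat) : Prop :=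
  [/\ #|G| = v, regular k, is_girth g &
      forall E : {set G}, E \in edges ->
        #|[set C in cycles_of_length g | E \in C]| = l].

End Defs.

(* Main.v *)
Require Import Defs.
From mathcomp Require Import all_boot zify.
Set Implicit Arguments.
Unset Strict Implicit.
Unset Printing Implicit Defensive.

(** A 7-cycle through a path x-u-y is determined by its subpath p-x-u-y-q, and p,
    q can be chosen in four ways.  Comparing the numbers of 7-cycles through the
    three edges at u shows that, when every edge lies in six 7-cycles, every path
    x-u-y lies in exactly three, so exactly one of its four extensions
    p-x-u-y-q is not closed by a 7-cycle.  Applied to all the paths of length 2
    near u, this determines the ball of radius 3 around u up to six binary
    choices.  In each of the 64 cases the ball contains a path of length 2 with
    two extensions that cannot be closed, whatever lies outside the ball. *)

Lemma map_uniq_inj (T T' : eqType) (f : T -> T') s :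
  uniq (map f s) -> {in s &, injective f}.
Proof.
elim: s => //= a s IH /andP[fas us] x y; rewrite !inE.
case/predU1P=> [->|xs] /predU1P[->|ys] // e; last exact: IH.
  by rewrite e map_f in fas.
by rewrite -e map_f in fas.
Qed.

(** * The labelled ball of radius 3 *)

(* 0 is the centre u and 1, 2, 3 are its neighbours; the children of 1 + g are
   4 + 2g and 5 + 2g, thin (see [thin]) towards the cyclically next, resp.
   previous, neighbour of u; 10 + 4g, ..., 13 + 4g are the leaves l, t, l', t' of
   [branch]. *)
Definition tree_nbs : seq (seq nat) :=
  [:: [:: 1; 2; 3]; [:: 0; 4; 5]; [:: 0; 6; 7]; [:: 0; 8; 9];
      [:: 1; 10; 11]; [:: 1; 12; 13]; [:: 2; 14; 15]; [:: 2; 16; 17];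
      [:: 3; 18; 19]; [:: 3; 20; 21]].

Definition tree_edges : seq (nat * nat) :=
  [seq (i, j) | i <- iota 0 10, j <- [seq j <- nth [::] tree_nbs i | i < j]].

(* The conclusion of [sphere_edges] for two branches whose leaves are numbered
   from [a] and from [b]. *)
Definition cross_edges (s r : bool) (a b : nat) : seq (nat * nat) :=
  [:: (a, b + r); (b + 2, a + 2 + s); (a + 3 - s, b + 1 - r)].

(** The comprehension over [nseq (s || r) tt] keeps its pair only if [s || r]; otherwise that pair
    is the third edge of [cross_edges]. *)
Definition cross_nonedges (s r : bool) (a b : nat) : seq (nat * nat) :=
  [:: (a + 1, a + 3); (a + 1, b + 1); (a + 1, b + 3); (a + 3, b + 3)]
    ++ [seq (a + 3, b + 1) | _ <- nseq (s || r) tt].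

Definition ball_edges s1 r1 s2 r2 s3 r3 :=
  tree_edges ++ cross_edges s1 r1 10 14 ++ cross_edges s2 r2 14 18
    ++ cross_edges s3 r3 18 10.

Definition ball_nonedges s1 r1 s2 r2 s3 r3 :=
  cross_nonedges s1 r1 10 14 ++ cross_nonedges s2 r2 14 18
    ++ cross_nonedges s3 r3 18 10.

Definition nbs (E : seq (nat * nat)) (i : nat) : seq nat :=
  [seq e.2 | e <- E & e.1 == i] ++ [seq e.1 | e <- E & e.2 == i].

Definition nb_table E := [seq nbs E i | i <- iota 0 22].

Section Table.
Variable t : seq (seq nat).
Local Notation K := (nth [::] t).

(* Exactly the labels with a neighbour outside the ball: the nonadjacencies
   listed in [NE] ensure that two of them are adjacent only if the table says so. *)
Definition open i := size (K i) < 3.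

(* A sufficient condition: a vertex outside the ball is only adjacent to open
   labels, and two vertices outside the ball count as possibly adjacent. *)
Definition unlinked x p y q :=
  [&& all (fun a => (a == x) || all (fun b => (b == y) || (b \notin K a)) (K q))
          (K p),
      open p ==> ~~ open q && all (fun b => (b == y) || ~~ open b) (K q)
    & open q ==> ~~ open p && all (fun a => (a == x) || ~~ open a) (K p)].

(** The ends of extensions p-x-i-y-q inside the ball that no 7-cycle can close. *)
Definition bad_pairs i x y :=
  [seq (p, q) | p <- [seq p <- K x | p != i],
                q <- [seq q <- K y | (q != i) && unlinked x p y q]].

(** The contradiction sought: by [unlinked_unique] a path x-i-y has at most one unlinked
    extension. *)
Definition two_bad_pairs :=
  has (fun i => has (fun x => has (fun y =>
    (x != y) && (1 < size (undup (bad_pairs i x y)))) (K i)) (K i)) (iota 0 22).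

(** Makes the table decide adjacency between labels: three listed neighbours exhaust a vertex, and
    each pair of distinct open labels is settled by the table or by [NE]. *)
Definition table_ok (NE : seq (nat * nat)) :=
  all (fun i => [&& uniq (K i), size (K i) <= 3, all (fun j => j < 22) (K i)
    & all (fun j => [|| i == j, ~~ open i, ~~ open j, j \in K i,
                        (i, j) \in NE | (j, i) \in NE]) (iota 0 22)])
    (iota 0 22).
End Table.

Definition parent i :=
  if i < 4 then 0 else if i < 10 then (i - 4)./2.+1 else (i - 10)./2 + 4.

(** Parents have smaller labels, so the larger endpoint is never an ancestor of the other and can
    step to its parent. The fuel [n] bounds the number of vertices; seven suffice, as for two leaves
    in different branches. *)
Fixpoint tree_path n i j :=
  if n is n'.+1 then
    if i == j then [:: i]
    else if i < j then rcons (tree_path n' i (parent j)) j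
    else i :: tree_path n' (parent i) j
  else [::].

(** Both [i] and [k] must be listed around [j], since distinct labels of one list are known to name
    distinct vertices; this makes the image walk non-backtracking. *)
Fixpoint tree_walk w :=
  if w is i :: w' then
    [&& if w' is j :: w'' then
          ((j \in nth [::] tree_nbs i) || (i \in nth [::] tree_nbs j)) &&
          (if w'' is k :: _ then
             [&& i != k, i \in nth [::] tree_nbs j & k \in nth [::] tree_nbs j]
           else true)
        else true & tree_walk w']
  else true.

Lemma tree_paths : all (fun i => all (fun j => (i == j) ||
  let w := tree_path 7 i j in
  [&& tree_walk w, 1 < size w <= 7, head 0 w == i & last 0 w == j])
   (iota 0 22)) (iota 0 22).
Proof. by vm_compute. Qed.

Lemma all_tables_bad s1 r1 s2 r2 s3 r3 :
  let t := nb_table (ball_edges s1 r1 s2 r2 s3 r3) in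
  table_ok t (ball_nonedges s1 r1 s2 r2 s3 r3) && two_bad_pairs t.
Proof.
by case: s1; case: r1; case: s2; case: r2; case: s3; case: r3; vm_compute.
Qed.

(** * Cycles of length 7 in cubic graphs *)

Section Cubic.
Variable G : sgraph.
Implicit Types (u v w x y z p q l m : G) (s : seq G).

Lemma adjC x y : adj x y = adj y x.
Proof. exact: adj_sym. Qed.

(* Non-backtracking walks. *)
Fixpoint nbwalk s : bool :=
  if s is x :: s' then
    [&& if s' is y :: s'' then adj x y && (if s'' is z :: _ then x != z else true)
        else true & nbwalk s']
  else true.

Lemma nbwalk_path x s : nbwalk (x :: s) -> path (@adj G) x s.
Proof.
by elim: s x => //= y s IH x /andP[/andP[-> _] w]; rewrite IH.
Qed.

(** The segment of the walk between two occurrences of a vertex would be a cycle of length at most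
    6. *)
Lemma nbwalk_uniq s : (forall c : seq G, cycle_seq c -> 6 < size c) ->
  nbwalk s -> size s <= 7 -> uniq s.
Proof.
move=> girth; elim: s => // x s IH ws le_s7.
have us : uniq s by apply: IH; [case/andP: ws | rewrite ltnW].
rewrite cons_uniq us andbT; apply/negP => xs.
have := nbwalk_path ws; case/splitPr: xs us ws le_s7 => s1 s2.
move=> /[!cat_uniq] /and3P[us1 /norP[xs1 _] _] ws /=.
rewrite size_cat cat_path /= addnS !ltnS => le_s6 /and3P[ps1 s1x _].
suff /girth : cycle_seq (x :: s1).
  by rewrite /= ltnS leqNgt ltnS (leq_trans (leq_addr _ _) le_s6).
rewrite /cycle_seq /= xs1 us1 rcons_path ps1 s1x !andbT !ltnS.
(* A segment too short to be a cycle is a loop or an immediate return. *)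
case: s1 ws s1x {us1 xs1 le_s6 ps1} => [|a [|b s1]] //=.
  by rewrite adj_irrefl.
by rewrite eqxx !andbF.
Qed.

Definition nb v x y z := [/\ uniq [:: x; y; z] & adj v =1 mem [:: x; y; z]].

Lemma nb_rot v x y z : nb v x y z -> nb v y z x.
Proof.
case=> u e; split.
  move: u; rewrite /= !inE !negb_or -!andbA (eq_sym y x) (eq_sym z x).
  by case/and4P=> -> -> -> _.
by move=> w; rewrite e /= !inE; do 3!case: (w == _).
Qed.

Lemma nb_swap v x y z : nb v x y z -> nb v x z y.
Proof.
case=> u e; split.
  by move: u; rewrite /= !inE !negb_or -!andbA (eq_sym z y) => /and4P[-> -> -> _].
by move=> w; rewrite e /= !inE; do 3!case: (w == _).
Qed.

Lemma nbP v x y z : nb v x y z ->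
  [/\ adj v x, adj v y & adj v z] /\ [/\ x != y, x != z & y != z].
Proof.
case=> u e; rewrite !e !inE !eqxx !orbT; split=> //.
by move: u; rewrite /= !inE negb_or -andbA => /and4P[].
Qed.

Lemma nb_exists v : regular G 3 -> exists x y z, nb v x y z.
Proof.
move=> /(_ v); rewrite cardE.
case E: (enum _) (enum_uniq [set w | adj v w]) => [|x [|y [|z []]]] //= u _.
exists x, y, z; split=> // w.
by have := mem_enum [set w | adj v w] w; rewrite E [in RHS]inE => <-.
Qed.

Lemma nb_extend v x : regular G 3 -> adj v x -> exists y z, nb v x y z.
Proof.
move=> reg vx; have [a [b [c n]]] := nb_exists v reg.
move: vx (n) => vx [_ e]; move: vx; rewrite e !inE => /or3P[] /eqP->.
- by exists b, c.
- by exists c, a; apply: nb_rot.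
- by exists a, b; do 2!apply: nb_rot.
Qed.

(* For a path p-x-u-y-q: it lies on a 7-cycle p-x-u-y-q-m-l. *)
Definition link x p y q :=
  [exists l, exists m, [&& adj p l, l != x, adj q m, m != y & adj l m]].

Lemma linkP x p y q :
  reflect (exists l m, [/\ adj p l, l != x, adj q m, m != y & adj l m])
          (link x p y q).
Proof.
apply: (iffP existsP) => [[l /existsP[m /and5P[]]]|[l [m [? ? ? ? ?]]]].
  by exists l, m.
by exists l; apply/existsP; exists m; apply/and5P.
Qed.

Lemma linkC x p y q : link x p y q = link y q x p.
Proof.
by apply/linkP/linkP => -[l [m [? ? ? ? ?]]]; exists m, l; split; rewrite // adjC.
Qed.

(** In girth 7, the size is the number of 7-cycles through x-u-y: by [link_unique] each pair of ends
    is closed in only one way. *)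
Definition links u x y :=
  [set pq : G * G | [&& adj x pq.1, pq.1 != u, adj y pq.2, pq.2 != u
                      & link x pq.1 y pq.2]].

Lemma links_sym u x y : #|links u x y| = #|links u y x|.
Proof.
have inj : injective (fun pq : G * G => (pq.2, pq.1)).
  by move=> [a b] [c d] [-> ->].
rewrite -(card_imset _ inj); apply: eq_card => -[q p].
apply/imsetP/idP => [[[p' q']] + [-> ->]|].
  by rewrite !inE /= linkC => /and5P[-> -> -> -> ->].
rewrite inE /= => /and5P[? ? ? ? ?]; exists (p, q) => //.
by rewrite inE /= linkC; apply/and5P.
Qed.

(** * Cycles as edge sets and as vertex sequences *)

Lemma cycle_edges_rot n s : uniq s -> cycle_edges (rot n s) = cycle_edges s.
Proof.
move=> us; apply/setP=> E; apply/imsetP/imsetP => -[x xs ->]; exists x => //.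
- by rewrite mem_rot in xs.
- by rewrite next_rot.
- by rewrite mem_rot.
- by rewrite next_rot.
Qed.

Lemma cycle_edges_rev s : uniq s -> cycle_edges (rev s) = cycle_edges s.
Proof.
move=> us; apply/setP=> E; apply/imsetP/imsetP => -[x xs ->].
  exists (prev s x); first by rewrite mem_prev -mem_rev.
  by rewrite next_prev // next_rev // setUC.
exists (next s x); first by rewrite mem_rev mem_next.
by rewrite next_rev // prev_next // setUC.
Qed.

Lemma cycle_seq_rot n s : cycle_seq (rot n s) = cycle_seq s.
Proof. by rewrite /cycle_seq size_rot rot_uniq rot_cycle. Qed.

Lemma cycle_seq_rev s : cycle_seq (rev s) = cycle_seq s.
Proof.
rewrite /cycle_seq size_rev rev_uniq rev_cycle.
by congr [&& _, _ & _]; apply: eq_cycle => x y; rewrite adjC.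
Qed.

Lemma set2_eq (T : finType) (a b c d : T) :
  [set a; b] = [set c; d] -> (a = c /\ b = d) \/ (a = d /\ b = c).
Proof.
move=> e; have := set21 a b; have := set22 a b; rewrite e !inE.
have := set21 c d; have := set22 c d; rewrite -e !inE.
do 4![case/orP=> /eqP ?]; subst; auto.
Qed.

Lemma edge_of_cycle s x y : uniq s ->
  [set x; y] \in cycle_edges s -> y = next s x \/ x = next s y.
Proof. by move=> us /imsetP[a _ /set2_eq[][-> ->]]; auto. Qed.

Lemma rotate_to_edge s x y : cycle_seq s -> [set x; y] \in cycle_edges s ->
  exists s', [/\ cycle_seq [:: x, y & s'], size [:: x, y & s'] = size s
               & cycle_edges [:: x, y & s'] = cycle_edges s].
Proof.
have main t : cycle_seq t -> x \in t -> y = next t x ->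
    exists s', [/\ cycle_seq [:: x, y & s'], size [:: x, y & s'] = size t
                 & cycle_edges [:: x, y & s'] = cycle_edges t].
  move=> ct xt ->; have /and3P[_ ut _] := ct.
  case: (rot_to xt) => i t' e; exists (behead t').
  have : cycle_seq (rot i t) by rewrite cycle_seq_rot.
  rewrite -(next_rot i ut) -(size_rot i t) -(cycle_edges_rot i ut) e.
  by case: t' {e} => [|b t'] //=; rewrite eqxx.
move=> cs; have /and3P[_ us _] := cs => /imsetP[a as_ /set2_eq[][ex ey]].
  by apply: main; rewrite ?ex ?ey.
(* Here the edge is traversed from [y] to [x], so the sequence is reversed first. *)
have xs : x \in s by rewrite ex mem_next.
have [||| s' [c1 c2 c3]] := main (rev s).
- by rewrite cycle_seq_rev.
- by rewrite mem_rev.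
- by rewrite next_rev // ex prev_next.
by exists s'; rewrite c1 c2 c3 size_rev cycle_edges_rev.
Qed.

Lemma next2_neq s v : uniq s -> 2 < size s -> v \in s -> next s (next s v) != v.
Proof.
move=> us s2 vs; have [i t e] := rot_to vs.
rewrite -2!(next_rot i us) e.
move: us s2; rewrite -(rot_uniq i) -(size_rot i) e.
case: t {e} => [|a [|b t]] //= /and3P[].
rewrite !inE !negb_or => /and3P[va vb _] _ _ _.
by rewrite eqxx (eq_sym a) (negPf va) eqxx eq_sym.
Qed.

Lemma cycle_edges_inj x y s t :
  cycle_seq [:: x, y & s] -> cycle_seq [:: x, y & t] -> size s = size t ->
  cycle_edges [:: x, y & s] = cycle_edges [:: x, y & t] -> s = t.
Proof.
set s' := [:: x, y & s]; set t' := [:: x, y & t] => cs ct sz eE.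
have /and3P[s2 us _] := cs; have /and3P[t2 ut _] := ct.
(* Two consecutive positions are carried: the next edge of [s'] lies in [t'], and traversing it
   backwards there would lead back to the preceding vertex. *)
have stepE k : iter k (next s') x = iter k (next t') x /\
    iter k.+1 (next s') x = iter k.+1 (next t') x.
  elim: k => [|k [IHv IHw]]; first by rewrite /= !eqxx.
  split=> //; move: IHv IHw; rewrite !iterS.
  set v := iter k (next s') x => <- IHw; rewrite -IHw.
  have vs : v \in s'.
    by rewrite /v; elim: (k) => [|j vj]; rewrite ?mem_head // iterS mem_next.
  have : [set next s' v; next s' (next s' v)] \in cycle_edges t'.
    by rewrite -eE; apply/imsetP; exists (next s' v); rewrite // mem_next.
  case/(edge_of_cycle ut) => //; rewrite {1}IHw => /(can_inj (prev_next ut)) e.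
  by have := next2_neq us s2 vs; rewrite -e eqxx.
have /fpathE es : fpath (next s') x (rcons (y :: s) x) := cycle_next us.
have /fpathE et : fpath (next t') x (rcons (y :: t) x) := cycle_next ut.
have : rcons (y :: s) x = rcons (y :: t) x.
  have [_ e0] := stepE 0; rewrite es et !size_rcons ![size (_ :: _)]/= sz.
  rewrite -[next t' x]e0; apply: (@eq_from_nth _ (next s' x)) => [|i].
    by rewrite !size_traject.
  rewrite size_traject => lt_i; rewrite !(nth_traject _ lt_i).
  by have [_] := stepE i; rewrite !iterSr => ->; congr iter.
by move/rcons_inj => [].
Qed.

(* Fixing the first two vertices selects one sequence for each cycle through the
   edge, since it fixes both the starting point and the direction. *)
Definition arc_cycles n x u :=
  [set s : n.-tuple G | cycle_seq s & take 2 s == [:: x; u]].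

Lemma arc_cyclesP n x u (s : n.-tuple G) : s \in arc_cycles n x u ->
  exists2 r, tval s = [:: x, u & r] & cycle_seq [:: x, u & r].
Proof.
rewrite inE => /andP[]; case: s => -[|a [|b r]] sz //= cs /eqP[ea eb].
by exists r; rewrite -?ea -?eb.
Qed.

Lemma card_arc_cycles n x u :
  #|[set C in cycles_of_length G n | [set x; u] \in C]| = #|arc_cycles n x u|.
Proof.
rewrite -(card_in_imset (f := fun s : n.-tuple G => cycle_edges s)) => [|s t].
  apply: eq_card => C; apply/idP/imsetP => [|[s sT ->]].
    rewrite inE => /andP[/imsetP[s]].
    rewrite inE => cs -> /(rotate_to_edge cs)[r []]; rewrite size_tuple.
    move=> cr /eqP sz er; exists (Tuple sz) => //.
    by rewrite inE cr /= take0 eqxx.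
  rewrite inE; have [r es cr] := arc_cyclesP sT.
  apply/andP; split.
    by apply/imsetP; exists s; rewrite // inE es.
  rewrite es; apply/imsetP; exists x; first exact: mem_head.
  by rewrite /= eqxx.
move=> /arc_cyclesP[r es cr] /arc_cyclesP[r' et cr'] e.
apply: val_inj; rewrite /= es et; congr [:: _, _ & _].
apply: (cycle_edges_inj cr cr'); last by rewrite -es -et.
by have := etrans (size_tuple s) (esym (size_tuple t)); rewrite es et => -[].
Qed.

(** * Counting 7-cycles through paths of length 2 *)

Hypothesis reg : regular G 3.
Hypothesis girth : forall c : seq G, cycle_seq c -> 6 < size c.

Lemma closed_nbwalk x s : size s <= 5 -> ~ nbwalk (x :: rcons s x).
Proof.
move=> le_s5 /(nbwalk_uniq girth).
by rewrite /= size_rcons mem_rcons mem_head => /(_ le_s5).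
Qed.

Ltac known := solve [assumption | by rewrite eq_sym | by rewrite adjC | done].
Ltac walk := rewrite /=; repeat (apply/andP; split); known.
Ltac intro_andb := repeat match goal with
  | |- is_true (_ && _) -> _ => case/andP; let H := fresh "neq" in move=> H
  | |- is_true true -> _ => move=> _
  end.
(** Refutes a context in which x, s, x is a closed non-backtracking walk with at most six edges. *)
Ltac loop x s := exfalso; apply: (@closed_nbwalk x s isT); walk.

Lemma arm_uniq u x p l y q m : adj u x -> adj u y -> x != y ->
  adj x p -> p != u -> adj y q -> q != u ->
  adj p l -> l != x -> adj q m -> m != y ->
  uniq [:: l; p; x; u; y; q; m].
Proof. by move=> *; apply: (nbwalk_uniq girth) => //; walk. Qed.

(** Two different closures would produce a 4-cycle through [p] or [q], or a 6-cycle through both. *)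
Lemma link_unique u x p y q l m l' m' : adj u x -> adj u y -> x != y ->
  adj x p -> p != u -> adj y q -> q != u ->
  adj p l -> l != x -> adj q m -> m != y -> adj l m ->
  adj p l' -> l' != x -> adj q m' -> m' != y -> adj l' m' ->
  l = l' /\ m = m'.
Proof.
move=> ux uy xy xp pu yq qu pl lx qm my lm pl' lx' qm' my' lm'.
have := arm_uniq ux uy xy xp pu yq qu pl' lx' qm my.
have := arm_uniq ux uy xy xp pu yq qu pl lx qm' my'.
rewrite /= !inE !negb_or -!andbA.
intro_andb.
case: (eqVneq l l') (eqVneq m m') => [?|ll'] [?|mm']; subst=> //.
- by loop l' [:: m; q; m'].
- by loop l [:: p; l'; m'].
- by loop l [:: p; l'; m'; q; m].
Qed.

(** A 7-cycle starting with x, u continues to [y] or to [z], and is then determined by the linked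
    pair next to its ends. *)
Lemma card_arc_links u x y z : nb u x y z ->
  #|arc_cycles 7 x u| = #|links u x y| + #|links u x z|.
Proof.
move=> nu; have [[ux uy uz] [xy xz yz]] := nbP nu.
(* In a cycle x, u, w, q, m, l, p these positions hold w, p and q. *)
pose h (s : 7.-tuple G) := (nth x s 2, (nth x s 6, nth x s 3)).
have inj w : injective (fun pq : G * G => (w, pq)) by move=> ? ? [].
pose A w := [set (w, pq) | pq in links u x w].
have cA w : #|A w| = #|links u x w| by rewrite card_imset.
have AI : A y :&: A z = set0.
  apply/setP=> w; rewrite !inE; apply/andP=> -[/imsetP[? _ ->]].
  by case/imsetP => ? _ [/eqP]; rewrite (negPf yz).
rewrite -!cA -cardsUI AI cards0 addn0.
have arcP (s : 7.-tuple G) : s \in arc_cycles 7 x u -> exists w q m l p,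
    [/\ tval s = [:: x; u; w; q; m; l; p], cycle_seq [:: x; u; w; q; m; l; p],
        adj u w & x != w].
  move=> /arc_cyclesP[r es cr]; have := size_tuple s; move: cr; rewrite es.
  case: r es => [|w [|q [|m [|l [|p []]]]]] //= es cs _.
  exists w, q, m, l, p; split=> //; case/and3P: cs => _ /=.
    by move=> _ /and3P[].
  by rewrite !inE !negb_or -!andbA => /and3P[].
rewrite -(card_in_imset (f := h)) => [|s t].
  apply: eq_card => w; apply/imsetP/idP => [[s sT ->]|].
    have [w0 [q [m [l [p [es cs uw xw]]]]]] := arcP s sT.
    rewrite /h es /=.
    have lk : (p, q) \in links u x w0.
      rewrite inE /=; have /and3P[_] := cs.
      rewrite /= !inE !negb_or -!andbA; intro_andb.
      intro_andb.
      apply/and5P; split; try known.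
      apply/linkP; exists l, m; split; known.
    case: nu => _ /(_ w0); rewrite uw /= !inE => /esym/or3P[] /eqP e; subst.
    - by rewrite eqxx in xw.
    - by apply/orP; left; apply: imset_f.
    - by apply/orP; right; apply: imset_f.
  have main v : v = y \/ v = z -> w \in A v ->
     exists2 s, s \in arc_cycles 7 x u & w = h s.
    move=> vyz /imsetP[[p q]]; rewrite inE /= => /and5P[xp pu vq qu].
    move=> /linkP[l [m [pl lx qm mv lm]]] ->.
    have [uv xv] : adj u v /\ x != v by case: vyz => ->.
    have := arm_uniq ux uv xv xp pu vq qu pl lx qm mv; rewrite /= !inE !negb_or -!andbA.
    intro_andb.
    exists [tuple x; u; v; q; m; l; p] => //.
    rewrite inE /= eqxx andbT /cycle_seq /= !inE !negb_or -!andbA.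
    walk.
  by rewrite inE => /orP[] /main; apply; auto.
move=> /arcP[w [q [m [l [p [es cs uw xw]]]]]].
move=> /arcP[w' [q' [m' [l' [p' [et ct uw' xw']]]]]].
rewrite /h es et /= => -[? ? ?]; subst w' p' q'.
apply: val_inj; rewrite /= es et.
have /and3P[_] := cs; have /and3P[_] := ct.
rewrite /= !inE !negb_or -!andbA; intro_andb; intro_andb; intro_andb; intro_andb.
have [] := @link_unique u x p w q l m l' m' ; try known.
by move=> -> ->.
Qed.

Hypothesis six : forall E : {set G}, E \in edges G ->
  #|[set C in cycles_of_length G 7 | E \in C]| = 6.

Lemma links_sum u x y z : nb u x y z -> #|links u x y| + #|links u x z| = 6.
Proof.
move=> nu; rewrite -(card_arc_links nu) -card_arc_cycles six //.
have [[ux _ _] _] := nbP nu.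
by apply/imsetP; exists (x, u); rewrite // inE adjC.
Qed.

(** The three paths centred at [u] have counts whose pairwise sums are all 6. *)
Lemma card_links u x y z : nb u x y z -> #|links u x y| = 3.
Proof.
move=> nu; have := links_sum nu; have := links_sum (nb_rot nu).
have := links_sum (nb_rot (nb_rot nu)).
rewrite (links_sym u y x) (links_sym u z x) (links_sym u z y).
lia.
Qed.

Lemma three_links u x y z p p' q q' :
  nb u x y z -> nb x u p p' -> nb y u q q' ->
  link x p y q + link x p y q' + link x p' y q + link x p' y q' = 3.
Proof.
move=> nu nx ny; rewrite -(card_links nu).
have [[_ xp xp'] [up up' pp']] := nbP nx.
have [[_ yq yq'] [uq uq' qq']] := nbP ny.
pose s := [:: (p, q); (p, q'); (p', q); (p', q')].
have us : uniq [seq pq <- s | link x pq.1 y pq.2].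
  rewrite filter_uniq //= !inE !negb_or -!pair_eqE /= !eqxx /=.
  by rewrite (negPf pp') (negPf qq').
transitivity (count (fun pq => link x pq.1 y pq.2) s).
  by rewrite /= addn0 !addnA.
rewrite -size_filter -(card_uniqP us); apply: eq_card => -[a b].
rewrite mem_filter !inE -!pair_eqE /=.
case: nx => _ /(_ a) ->; case: ny => _ /(_ b) ->; rewrite /= !inE.
case: (eqVneq a u) => [->|_] /=; first by rewrite (negPf up) (negPf up') andbF.
case: (eqVneq b u) => [->|_] /=.
  by rewrite (negPf uq) (negPf uq') !andbF.
by case: link; case: (a == p); case: (a == p'); case: (b == q); case: (b == q').
Qed.

Lemma nb_child v x y z w : nb v x y z -> adj v w -> w != x -> w = y \/ w = z.
Proof.
by move=> [_ e]; rewrite e /= !inE => /or3P[] /eqP-> //; rewrite ?eqxx; auto.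
Qed.

(** Three of the four extensions are linked, which leaves only one. *)
Lemma unlinked_unique u x y p q p' q' : adj u x -> adj u y -> x != y ->
  adj x p -> p != u -> adj y q -> q != u -> ~~ link x p y q ->
  adj x p' -> p' != u -> adj y q' -> q' != u -> ~~ link x p' y q' ->
  p = p' /\ q = q'.
Proof.
move=> ux uy xy xp pu yq qu npq xp' p'u yq' q'u npq'.
have [y' [z' ny]] := nb_extend reg ux.
have [z nu] : exists z, nb u x y z.
  case: (nb_child ny uy); rewrite 1?eq_sym // => e; subst; first by exists z'.
  by exists y'; apply: nb_swap.
rewrite adjC in ux; rewrite adjC in uy.
have [p1 [p2 nx]] := nb_extend reg ux; have [q1 [q2 nqy]] := nb_extend reg uy.
have := three_links nu nx nqy.
case: (nb_child nx xp pu) (nb_child nx xp' p'u) => [?|?] [?|?];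
case: (nb_child nqy yq qu) (nb_child nqy yq' q'u) => [?|?] [?|?];
by subst=> //; clear -npq npq'; lia.
Qed.

(** * Edges between the leaves of the ball *)

Lemma single_child u x y p l q m q' m' :
  adj u x -> adj u y -> x != y -> adj x p -> p != u -> adj p l -> l != x ->
  adj y q -> q != u -> adj q m -> m != y -> adj l m ->
  adj y q' -> q' != u -> adj q' m' -> m' != y -> adj l m' -> q = q'.
Proof.
move=> ux uy xy xp pu pl lx yq qu qm my lm yq' qu' qm' my' lm'.
have := arm_uniq ux uy xy xp pu yq qu pl lx qm my.
have := arm_uniq ux uy xy xp pu yq' qu' pl lx qm' my'.
rewrite /= !inE !negb_or -!andbA; intro_andb; intro_andb.
(* If [q] and [q'] differ, the paths from [l] to [y] through them close up to a 6-cycle, or to a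
   4-cycle when m = m'. *)
case: (eqVneq q q') (eqVneq m m') => // qq' [?|mm']; subst.
- by loop m' [:: q; y; q'].
- by loop l [:: m; q; y; q'; m'].
Qed.

(** The 7-cycle l, p, x, u, y, q, m is read from the centre [x] on the left and from [u] on the
    right. Thus a link centred at [x] becomes an edge from [l] to a leaf beyond [y]. *)
Lemma linkE u x y z p p' l t : nb u x y z -> nb x u p p' -> nb p x l t ->
  link p l u y <->
  exists q m, [/\ adj y q, q != u, adj q m, m != y & adj l m].
Proof.
move=> nu nx np.
have [[ux uy _] [xy _ _]] := nbP nu; have [[_ xp _] [up _ _]] := nbP nx.
have [[_ pl _] [xl _ _]] := nbP np; rewrite eq_sym in up; rewrite eq_sym in xl.
have := nbwalk_uniq girth (s := [:: l; p; x; u; y]).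
rewrite /nbwalk adjC pl xl adjC xp up (adjC x) ux xy uy => /(_ isT isT).
rewrite /= !inE !negb_or -!andbA; intro_andb.
split=> [/linkP[m [q]]|[q [m [yq qu qm my lm]]]].
  case=> lm mp yq qu; rewrite adjC => qm.
  exists q, m; split=> //; apply/eqP=> ?; subst.
  by loop l [:: p; x; u; y].
have := arm_uniq ux uy xy xp up yq qu pl xl qm my.
rewrite /= !inE !negb_or -!andbA; intro_andb.
by apply/linkP; exists m, q; split; known.
Qed.

(* For nb u x y z, nb x u _ p and nb p x l t: of the four extensions of p-x-u to
   a leaf of p and a neighbour of u, t-p-x-u-y is the one on no 7-cycle. *)
Definition thin u p l t y z :=
  [&& link p l u y, link p l u z, link p t u z & ~~ link p t u y].

(** The only unlinked extension of p-x-u singles out both the leaf named [t] and the direction, [y]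
    or [z]. *)
Lemma thin_exists u x y z p p' : nb u x y z -> nb x u p p' ->
  exists l t, nb p x l t /\ (thin u p l t y z \/ thin u p l t z y).
Proof.
move=> nu nx; have [[_ xp _] _] := nbP nx; rewrite adjC in xp.
have [l [t np]] := nb_extend reg xp.
have := three_links (nb_swap (nb_rot nx)) np nu => e.
have : [\/ thin u p l t y z, thin u p l t z y, thin u p t l y z | thin u p t l z y].
  move: e; rewrite /thin.
  case: (link p l u y); case: (link p l u z); case: (link p t u y);
  case: (link p t u z) => // _;
  by [constructor 1|constructor 2|constructor 3|constructor 4].
by case=> th; [exists l, t|exists l, t|exists t, l|exists t, l]; split; auto;
  apply: nb_swap.
Qed.

(** As [t] has no neighbour among the leaves beyond [y], both links would run through [l], against
    [single_child]. *)
Lemma thin_not_both u x y z p p' l t q q' :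
  nb u x y z -> nb x u p p' -> nb p x l t -> nb y u q q' ->
  ~~ link p t u y -> ~~ (link x p y q && link x p y q').
Proof.
move=> nu nx np ny ty; apply/negP=> /andP[/linkP[a [m [pa ax qm my am]]]].
move=> /linkP[a' [m' [pa' ax' qm' my' am']]].
have [[_ yq yq'] [uq uq' qq']] := nbP ny.
rewrite eq_sym in uq; rewrite eq_sym in uq'.
have only_l b r n : adj p b -> b != x -> adj y r -> r != u ->
    adj r n -> n != y -> adj b n -> b = l.
  move=> pb bx yr ru rn ny' bn; case: (nb_child np pb bx) => // ?; subst.
  case/negP: ty; apply/(linkE nu nx (nb_swap np)).
  by exists r, n.
have ? := only_l _ _ _ pa ax yq uq qm my am; subst.
have ? := only_l _ _ _ pa' ax' yq' uq' qm' my' am'; subst.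
have [[ux uy _] [xy _ _]] := nbP nu; have [[_ xp _] [up _ _]] := nbP nx.
rewrite eq_sym in up.
have := single_child ux uy xy xp up pa ax yq uq qm my am yq' uq' qm' my' am'.
by move/eqP; rewrite (negPf qq').
Qed.

(** Two children thin towards [y] would give at most one link each, but x-u-y has three. *)
Lemma thin_distinct u x y z p p' l t l' t' :
  nb u x y z -> nb x u p p' -> nb p x l t -> nb p' x l' t' ->
  ~~ link p t u y -> ~~ link p' t' u y -> False.
Proof.
move=> nu nx np np' ty ty'.
have [[_ uy _] _] := nbP nu; rewrite adjC in uy.
have [q [q' ny]] := nb_extend reg uy.
have := thin_not_both nu nx np ny ty.
have := thin_not_both nu (nb_swap nx) np' ny ty'.
have := three_links nu nx ny; lia.
Qed.

(** The children of [x] are thin in different directions ([thin_distinct]), which orders them;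
    thinness also orders the leaves of each. *)
Definition branch u x y z p l t p' l' t' :=
  [/\ nb x u p p', nb p x l t, nb p' x l' t', thin u p l t y z
     & thin u p' l' t' z y].

Lemma branch_exists u x y z : nb u x y z ->
  exists p l t p' l' t', branch u x y z p l t p' l' t'.
Proof.
move=> nu; have [[ux _ _] _] := nbP nu; rewrite adjC in ux.
have [p [p' nx]] := nb_extend reg ux.
have [l [t [np th]]] := thin_exists nu nx.
have [l' [t' [np' th']]] := thin_exists nu (nb_swap nx).
have D y' z' : nb u x y' z' -> thin u p l t y' z' -> thin u p' l' t' y' z' -> False.
  move=> nu0 /and4P[_ _ _ ty] /and4P[_ _ _ ty'].
  exact: (thin_distinct nu0 nx np np').
case: th th' => th [] th'.
- by case: (D y z).
- by exists p, l, t, p', l', t'.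
- by exists p', l', t', p, l, t; split=> //; apply: nb_swap.
- by case: (D z y) => //; apply: nb_swap.
Qed.

Lemma unlinked_leaf u x y z p p' l t q q' m n :
  nb u x y z -> nb x u p p' -> nb p x l t -> nb y u q q' -> nb q y m n ->
  ~~ link p l u y -> ~~ adj l m.
Proof.
move=> nu nx np ny nq; apply: contra => lm; apply/(linkE nu nx np).
have [[_ yq _] [uq _ _]] := nbP ny; have [[_ qm _] [ym _ _]] := nbP nq.
by exists q, m; split; known.
Qed.

(** Each of the three links between the two branches is a single edge between leaves. The choice [r]
    says whether the link of [p] and [q] ends in [n], and [s] whether that of [p'] and [q'] ends in
    [t']; the third link takes the other leaves of [p'] and [q]. *)
Lemma sphere_edges u x y z p l t p' l' t' q m n q' m' n' : nb u x y z ->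
  branch u x y z p l t p' l' t' -> branch u y z x q m n q' m' n' ->
  exists s r : bool,
    [/\ adj l (if r then n else m), adj m' (if s then t' else l'),
        adj (if s then l' else t') (if r then m else n)
      & [/\ ~~ adj t n, ~~ adj t n', ~~ adj t' n'
          & s || r -> ~~ adj t' n]].
Proof.
move=> nu [nx np np' /and4P[_ _ _ ty] _] [ny nq nq' _ /and4P[_ _ _ nx']].
have nuyx : nb u y x z by apply: nb_rot; apply: nb_rot; apply: nb_swap.
have np't := nb_swap np'.
have ntm := unlinked_leaf nu nx (nb_swap np) ny nq ty.
have ntn := unlinked_leaf nu nx (nb_swap np) ny (nb_swap nq) ty.
have ntm' := unlinked_leaf nu nx (nb_swap np) (nb_swap ny) nq' ty.
have ntn' := unlinked_leaf nu nx (nb_swap np) (nb_swap ny) (nb_swap nq') ty.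
have nn'l' := unlinked_leaf nuyx (nb_swap ny) (nb_swap nq') (nb_swap nx) np' nx'.
have nn't' := unlinked_leaf nuyx (nb_swap ny) (nb_swap nq') (nb_swap nx) np't nx'.
(* Thinness allows [p] and [q'] at most one link each, so with three links in total the unlinked
   pair is [p], [q']. *)
have [lpq lp'q' lp'q] : [/\ link x p y q, link x p' y q' & link x p' y q].
  have := thin_not_both nu nx np ny ty.
  have := thin_not_both nuyx (nb_swap ny) nq' nx nx'.
  rewrite !(linkC y); have := three_links nu nx ny.
  case: (link x p y q); case: (link x p y q'); case: (link x p' y q);
  by case: (link x p' y q').
have [[ux uy _] [xy _ _]] := nbP nu.
have [[_ xp xp'] [up up' pp']] := nbP nx.
have [[_ yq yq'] [uq uq' qq']] := nbP ny.
rewrite eq_sym in up; rewrite eq_sym in up'.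
rewrite eq_sym in uq; rewrite eq_sym in uq'.
case/linkP: lpq => a [b [pa ax qb yb ab]].
have ? : a = l.
  case: (nb_child np pa ax) => // ?; subst.
  by case: (nb_child nq qb yb) => ?; subst; [case/negP: ntm|case/negP: ntn].
subst a.
case/linkP: lp'q' => a' [b' [p'a' a'x q'b' b'y a'b']].
have ? : b' = m'.
  case: (nb_child nq' q'b' b'y) => // ?; subst; rewrite adjC in a'b'.
  by case: (nb_child np' p'a' a'x) => ?; subst; [case/negP: nn'l'|case/negP: nn't'].
subst b'.
case/linkP: lp'q => c [d [p'c cx qd dy cd]].
have ca' : c != a'.
  apply/eqP=> ?; subst.
  have := single_child ux uy xy xp' up' p'a' a'x yq uq qd dy cd yq' uq' q'b' b'y a'b'.
  by move/eqP; rewrite (negPf qq').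
have db : d != b.
  apply/eqP=> ?; subst; rewrite adjC in ab; rewrite adjC in cd.
  rewrite eq_sym in xy.
  have := single_child uy ux xy yq uq qb yb xp up pa ax ab xp' up' p'c cx cd.
  by move/eqP; rewrite (negPf pp').
(* An edge from [t'] to [n] would have to be the edge from [c] to [d], by uniqueness of the link,
   and [c], [d] differ from [a'], [b]. *)
have nqb' : (a' == t') || (b == n) -> ~~ adj t' n.
  apply: contraL => t'n; rewrite negb_or.
  have [[_ _ p't'] [_ xt' _]] := nbP np'; have [[_ _ qn] [_ yn _]] := nbP nq.
  rewrite eq_sym in xt'; rewrite eq_sym in yn.
  have [<- <-] := link_unique ux uy xy xp' up' yq uq p'c cx qd dy cd p't' xt' qn yn t'n.
  by rewrite eq_sym ca' eq_sym db.
exists (a' == t'), (b == n); split.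
- case: eqP => [<-|nb] //; by case: (nb_child nq qb yb) => // <-.
- rewrite adjC; case: eqP => [<-|nb] //; by case: (nb_child np' p'a' a'x) => // <-.
- case: (nb_child np' p'a' a'x) (nb_child np' p'c cx) => ? [] ?;
  case: (nb_child nq qb yb) (nb_child nq qd dy) => ? [] ?; subst;
  have [_ [_ _ ne1]] := nbP np'; have [_ [_ _ ne2]] := nbP nq;
  move: ca' db cd; rewrite ?eqxx ?(negPf ne1) ?(negPf ne2) //.
- by split=> //; rewrite adjC.
Qed.

Lemma cousins_nonadj u x p p' l t l' t' :
  nb x u p p' -> nb p x l t -> nb p' x l' t' -> ~~ adj t t'.
Proof.
move=> nx np np'; apply/negP=> tt'.
have [[_ xp xp'] [_ _ pp']] := nbP nx; have [[_ _ pt] [_ xt _]] := nbP np.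
have [[_ _ pt'] [_ xt' _]] := nbP np'.
have tp' : t != p' by apply/eqP=> ?; subst; loop p' [:: x; p].
by loop t [:: p; x; p'; t'].
Qed.

Lemma nb_intro v x y z : adj v x -> adj v y -> adj v z -> uniq [:: x; y; z] ->
  nb v x y z.
Proof.
move=> vx vy vz uxyz; split=> // w.
have sub : [set a in [:: x; y; z]] \subset [set a | adj v a].
  by apply/subsetP=> a; rewrite !inE => /or3P[] /eqP->.
have : [set a in [:: x; y; z]] = [set a | adj v a].
  by apply/eqP; rewrite eqEcard sub reg cardsE (card_uniqP uxyz).
by move/setP/(_ w); rewrite inE [in RHS]inE => <-.
Qed.

(** * Contradiction in every labelled ball *)

Section Labelling.
Variables (phi : nat -> G) (E NE : seq (nat * nat)).
Hypothesis tree_uniq : forall i, i < 10 -> uniq (map phi (nth [::] tree_nbs i)).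
Hypothesis E_adj : forall e, e \in E -> adj (phi e.1) (phi e.2).
Hypothesis NE_adj : forall e, e \in NE -> ~~ adj (phi e.1) (phi e.2).
Hypothesis tree_sub : {subset tree_edges <= E}.
Local Notation t := (nb_table E).
Local Notation K := (nth [::] t).
Hypothesis t_ok : table_ok t NE.

Lemma mem_K i j : j \in K i -> ((i, j) \in E) || ((j, i) \in E).
Proof.
case: (ltnP i 22) => [lt_i|le_i]; last by rewrite nth_default // size_map size_iota.
rewrite (nth_map 0) ?size_iota // nth_iota // mem_cat.
case/orP=> /mapP[[a b]]; rewrite mem_filter /= => /andP[/eqP-> abE] ->.
  by rewrite abE.
by rewrite abE orbT.
Qed.

Lemma K_adj i j : j \in K i -> adj (phi i) (phi j).
Proof. by case/mem_K/orP => /E_adj //=; rewrite adjC. Qed.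

Lemma K_sym i j : i < 22 -> j \in K i -> j < 22 -> i \in K j.
Proof.
move=> lt_i /mem_K ij lt_j.
rewrite (nth_map 0) ?size_iota // nth_iota // mem_cat.
case/orP: ij => ijE; apply/orP; [right|left]; apply/mapP.
  by exists (i, j); rewrite // mem_filter /= eqxx.
by exists (j, i); rewrite // mem_filter /= eqxx.
Qed.

Lemma nbs_lt i j : j \in nth [::] tree_nbs i -> i < 10.
Proof. by case: (ltnP i 10) => // le_i; rewrite nth_default. Qed.

Lemma tree_adj i j : j \in nth [::] tree_nbs i -> adj (phi i) (phi j).
Proof.
move=> ij; have lt_i := nbs_lt ij.
have edge : all (fun i => all (fun j => ((i, j) \in tree_edges) ||
  ((j, i) \in tree_edges)) (nth [::] tree_nbs i)) (iota 0 10) by [].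
have /allP/(_ i) := edge; rewrite mem_iota => /(_ lt_i)/allP/(_ j ij).
by case/orP=> /tree_sub/E_adj //=; rewrite adjC.
Qed.

Lemma tree_walk_nbwalk (w : seq nat) : tree_walk w -> nbwalk (map phi w).
Proof.
elim: w => // i [|j w] IH // /andP[/andP[ij kw] /IH {}IH].
rewrite -[map _ _]/(phi i :: map phi (j :: w)) [nbwalk _]/=.
apply/andP; split; last exact: IH.
apply/andP; split.
  by case/orP: ij => /tree_adj //; rewrite adjC.
case: w kw {IH} => //= k w /and3P[ik ij' kj].
have := map_uniq_inj (tree_uniq (nbs_lt ij')) ij' kj.
by move/contra_neq; apply.
Qed.

(** The tree path between two distinct labels is a non-backtracking walk on at most seven vertices,
    which girth 7 forces to be repetition-free. *)
Lemma phi_inj : {in gtn 22 &, injective phi}.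
Proof.
move=> i j lt_i lt_j e; apply/eqP; apply/negPn/negP => nij.
have /allP/(_ i) := tree_paths; rewrite mem_iota => /(_ lt_i)/allP/(_ j).
rewrite mem_iota (negPf nij) => /(_ lt_j) /and4P[].
move: (tree_path 7 i j) => w /tree_walk_nbwalk/(nbwalk_uniq girth).
rewrite size_map; case: w => [|a [|b w]] // + /andP[_ lt_w] /eqP ea /eqP ej.
move=> /(_ lt_w); rewrite map_cons cons_uniq => /andP[/negP[]].
by rewrite -[a]/(head 0 [:: a, b & w]) ea e -ej; apply: map_f; apply: mem_last.
Qed.

Lemma table_okP i : i < 22 -> [/\ uniq (K i), size (K i) <= 3, {in K i, forall j, j < 22}
  & forall j, j < 22 -> [|| i == j, ~~ open t i, ~~ open t j, j \in K i,
                        (i, j) \in NE | (j, i) \in NE]].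
Proof.
have /allP/(_ i) := t_ok; rewrite mem_iota => ok /ok{ok} /and4P[? ? /allP K22 /allP ok].
by split=> // j lt_j; apply: ok; rewrite mem_iota.
Qed.

Lemma phi_K_uniq i : i < 22 -> uniq (map phi (K i)).
Proof.
move=> lt_i; have [ui _ K22 _] := table_okP lt_i.
by rewrite map_inj_in_uniq // => a b /K22 ? /K22 ?; apply: phi_inj.
Qed.

Lemma full_adj i w : i < 22 -> ~~ open t i -> adj (phi i) w ->
  exists2 j, j \in K i & w = phi j.
Proof.
move=> lt_i; rewrite /open -leqNgt => ge3; have [_ le3 _ _] := table_okP lt_i.
have {le3 ge3} sz : size (K i) = 3 by apply/eqP; rewrite eqn_leq le3.
have := phi_K_uniq lt_i; have := @K_adj i.
case: (K i) sz => [|a [|b [|c []]]] //= _ adjK uK.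
have [||| _ ->] := nb_intro (v := phi i) _ _ _ uK.
- by apply: adjK; rewrite !inE eqxx ?orbT.
- by apply: adjK; rewrite !inE eqxx ?orbT.
- by apply: adjK; rewrite !inE eqxx ?orbT.
by rewrite /= !inE => /or3P[] /eqP->; [exists a|exists b|exists c];
  rewrite // !inE eqxx ?orbT.
Qed.

Lemma adj_K i j : i < 22 -> j < 22 -> adj (phi i) (phi j) -> j \in K i.
Proof.
move=> lt_i lt_j ij; have [_ _ _ /(_ j lt_j)] := table_okP lt_i.
case/or4P=> [/eqP e|/(full_adj lt_i) fi|/(full_adj lt_j) fj|].
- by move: ij; rewrite e adj_irrefl.
- have [k kK /phi_inj ->] := fi _ ij; rewrite ?inE //.
  by have [_ _ K22 _] := table_okP lt_i; apply: K22.
- rewrite adjC in ij; have [k kK ek] := fj _ ij.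
  have lt_k : k < 22 by have [_ _ K22 _] := table_okP lt_j; apply: K22.
  by rewrite (phi_inj _ _ ek) // K_sym.
case/or3P=> // /NE_adj /=; first by rewrite ij.
by rewrite adjC ij.
Qed.

(** Separates what the table knows from what lies outside the ball, which only open labels can
    reach. *)
Lemma label_child (p : nat) w : p < 22 -> adj (phi p) w ->
  (exists2 a, a \in K p & w = phi a) \/
  (open t p /\ forall j, j < 22 -> w != phi j).
Proof.
move=> lt_p pw; case op: (open t p); last by left; apply: full_adj; rewrite ?op.
case lab: (has (fun j => w == phi j) (iota 0 22)); [left|right; split=> //].
  case/hasP: lab => j; rewrite mem_iota /= => lt_j /eqP ej; exists j => //.
  by apply: adj_K; rewrite // -ej.
move=> j lt_j; apply: contraFN lab => ej; apply/hasP; exists j => //.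
by rewrite mem_iota.
Qed.

Lemma label_lt i j : i < 22 -> j \in K i -> j < 22.
Proof. by move=> /table_okP[_ _ K22 _] /K22. Qed.

Lemma open_of_outside b w : b < 22 -> adj (phi b) w ->
  (forall j, j < 22 -> w != phi j) -> open t b.
Proof.
move=> lt_b bw out; case: (label_child lt_b bw) => [[j jK ej]|[]//].
by have := out j (label_lt lt_b jK); rewrite ej eqxx.
Qed.

Lemma unlinked_sound (x p y q : nat) : p < 22 -> q < 22 ->
  unlinked t x p y q -> ~~ link (phi x) (phi p) (phi y) (phi q).
Proof.
move=> lt_p lt_q /and3P[/allP lab opn opn']; apply/linkP=> -[l [m [pl lx qm my lm]]].
(* Each of [l] and [m] is a label or outside the ball; both are outside only if [p] and [q] are both
   open, which [unlinked] forbids. *)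
case: (label_child lt_p pl) (label_child lt_q qm) =>
  [[a aK ?]|[op ol]] [[b bK ?]|[oq om]].
- subst; case/orP: (lab a aK) => [/eqP e|/allP/(_ b bK)]; first by rewrite e eqxx in lx.
  case/orP=> [/eqP e|/negP]; first by rewrite e eqxx in my.
  by apply; apply: adj_K (label_lt lt_p aK) (label_lt lt_q bK) lm.
- subst; have := opn'; rewrite oq => /andP[_ /allP/(_ a aK)].
  case/orP=> [/eqP e|/negP]; first by rewrite e eqxx in lx.
  by apply; apply: open_of_outside (label_lt lt_p aK) lm om.
- subst; have := opn; rewrite op => /andP[_ /allP/(_ b bK)].
  case/orP=> [/eqP e|/negP]; first by rewrite e eqxx in my.
  by apply; rewrite adjC in lm; apply: open_of_outside (label_lt lt_q bK) lm ol.
by have := opn; rewrite op oq.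
Qed.

Lemma phi_neq i j : i < 22 -> j < 22 -> i != j -> phi i != phi j.
Proof. by move=> lt_i lt_j; apply: contra_neq; apply: phi_inj. Qed.

Lemma bad_pairsP (i x y p q : nat) : i < 22 -> x \in K i -> y \in K i ->
  (p, q) \in bad_pairs t i x y ->
  [/\ p < 22, q < 22, adj (phi x) (phi p) /\ phi p != phi i,
      adj (phi y) (phi q) /\ phi q != phi i
    & ~~ link (phi x) (phi p) (phi y) (phi q)].
Proof.
move=> lt_i xK yK /allpairsPdep[p' [q' []]].
rewrite !mem_filter => /andP[pi pK] /andP[/andP[qi un] qK] [? ?]; subst p' q'.
have lt_p : p < 22 by apply: label_lt (label_lt lt_i xK) pK.
have lt_q : q < 22 by apply: label_lt (label_lt lt_i yK) qK.
by split; rewrite ?K_adj ?phi_neq ?unlinked_sound.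
Qed.

Lemma table_contradiction : ~~ two_bad_pairs t.
Proof.
apply/hasP=> -[i]; rewrite mem_iota /= => lt_i.
case/hasP=> x xK /hasP[y yK /andP[xy]].
case Eb: (undup _) (undup_uniq (bad_pairs t i x y)) => [|[p q] [|[p' q'] s]] //= u _.
have /(bad_pairsP lt_i xK yK) : (p, q) \in bad_pairs t i x y.
  by rewrite -mem_undup Eb mem_head.
have /(bad_pairsP lt_i xK yK) : (p', q') \in bad_pairs t i x y.
  by rewrite -mem_undup Eb !inE eqxx orbT.
move=> [lt_p' lt_q' [xp' pi'] [yq' qi'] np'] [lt_p lt_q [xp pi] [yq qi] np].
have xy' : phi x != phi y by apply: phi_neq xy; apply: (label_lt lt_i).
have [/phi_inj ep /phi_inj eq] := unlinked_unique (K_adj xK)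
  (K_adj yK) xy' xp pi yq qi np xp' pi' yq' qi' np'.
by move: u; rewrite ep // eq // inE eqxx.
Qed.

End Labelling.

Lemma no_vertex (u : G) : False.
Proof.
have [x [y [z nu]]] := nb_exists u reg.
have nu2 := nb_rot nu; have nu3 := nb_rot nu2.
have [p1 [l1 [t1 [q1 [m1 [n1 b1]]]]]] := branch_exists nu.
have [p2 [l2 [t2 [q2 [m2 [n2 b2]]]]]] := branch_exists nu2.
have [p3 [l3 [t3 [q3 [m3 [n3 b3]]]]]] := branch_exists nu3.
have [s1 [r1 [e11 e12 e13 [f11 f12 f13 f14]]]] := sphere_edges nu b1 b2.
have [s2 [r2 [e21 e22 e23 [f21 f22 f23 f24]]]] := sphere_edges nu2 b2 b3.
(* The three branches are in cyclic order, so the last is followed by the first. *)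
have [s3 [r3 [e31 e32 e33 [f31 f32 f33 f34]]]] := sphere_edges nu3 b3 b1.
(* The order realises the numbering of [tree_nbs], with the four leaves of each branch in
   consecutive positions from 10 on. *)
pose phi := nth u [:: u; x; y; z; p1; q1; p2; q2; p3; q3;
  l1; t1; m1; n1; l2; t2; m2; n2; l3; t3; m3; n3].
have /andP[ok bad] := all_tables_bad s1 r1 s2 r2 s3 r3.
case: b1 b2 b3 => [nx1 np1 nq1 _ _] [nx2 np2 nq2 _ _] [nx3 np3 nq3 _ _].
have g1 := cousins_nonadj nx1 np1 nq1.
have g2 := cousins_nonadj nx2 np2 nq2.
have g3 := cousins_nonadj nx3 np3 nq3.
apply/negP: bad; apply: (@table_contradiction phi _
  (ball_nonedges s1 r1 s2 r2 s3 r3)) => //.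
- have [[? _] [? _] [? _] [? _]] := And4 nu nx1 nx2 nx3.
  have [[? _] [? _] [? _]] := And3 np1 np2 np3.
  have [[? _] [? _] [? _]] := And3 nq1 nq2 nq3.
  by do 10!(case=> [//|]).
- have [[[? ? ?] _] [[_ ? ?] _] [[_ ? ?] _] [[_ ? ?] _]] :=
    And4 (nbP nu) (nbP nx1) (nbP nx2) (nbP nx3).
  have [[[_ ? ?] _] [[_ ? ?] _] [[_ ? ?] _]] :=
    And3 (nbP np1) (nbP np2) (nbP np3).
  have [[[_ ? ?] _] [[_ ? ?] _] [[_ ? ?] _]] :=
    And3 (nbP nq1) (nbP nq2) (nbP nq3).
  apply/allP; rewrite all_cat; apply/andP; split.
    by rewrite /tree_edges /phi /=; repeat (apply/andP; split).
  rewrite !all_cat; apply/and3P; split.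
  + by move: e11 e12 e13; rewrite /phi; case: (s1); case: (r1) => /= -> -> ->.
  + by move: e21 e22 e23; rewrite /phi; case: (s2); case: (r2) => /= -> -> ->.
  by move: e31 e32 e33; rewrite /phi; case: (s3); case: (r3) => /= -> -> ->.
- apply/allP; rewrite !all_cat; apply/and3P; split.
  + by rewrite /phi /= g1 f11 f12 f13; case: (s1 || r1) f14 => //= ->.
  + by rewrite /phi /= g2 f21 f22 f23; case: (s2 || r2) f24 => //= ->.
  by rewrite /phi /= g3 f31 f32 f33; case: (s3 || r3) f34 => //= ->.
by move=> e eT; rewrite mem_cat eT.
Qed.

End Cubic.

Theorem theorem4 (v : nat) (hv : 0 < v) :
  ~ exists G : sgraph, egr G v 3 7 6.
Proof.
case=> G [cardG reg [_ gir] six].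
move: hv; rewrite -cardG => /card_gt0P[u _].
apply: (no_vertex reg _ six u) => c cs; apply: gir.
by apply/set0Pn; exists (cycle_edges c); apply/imsetP; exists (in_tuple c); rewrite ?inE.
Qed.
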